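(* Suppose there are $n$ users and $m$ samples per user, where each sample $X_{i,j}\in[d]$ is the $j$th sample of user $i$. Suppose $M$ is an $(\varepsilon,\delta)$ user-level differentially private algorithm taking as input $X=\{X_{i,j}\}_{1\le i\le n,1\le j\le m}$, where $\delta=o\left(\frac{\varepsilon}{d^{3/2}\cdot m\cdot n^{1/2}\cdot\log^2(\varepsilon^{-1}mnd)}\right)$. Then there exists a distribution $\tilde p$ over $[d]$ such that if $X_{i,j}\overset{i.i.d.}{\sim}\tilde p$, then with probability at least $\frac13$ the total variation distance between $M(X)$ and $\tilde p$ is at least $$\Omega\left(\sqrt{\frac{d}{mn}}+\frac{d}{\varepsilon\cdot n\sqrt m\cdot\log^7(\varepsilon^{-1}mnd)}\right).$$
   Context: $M(X)$ is interpreted as a probability distribution (vector) over $[d]=\{1,\dots,d\}$. User-level differential privacy: datasets $X=\{X_{i,j}\}$, $X'=\{X'_{i,j}\}$ are neighboring if there is a single user $i$ such that $X_{i',j}=X'_{i',j}$ for all $i'\ne i$ and all $j$. A randomized algorithm $M$ is $(\varepsilon,\delta)$ user-level differentially private if for all neighboring $X,X'$ and all measurable $S$, $\mathbb{P}[M(X)\in S]\le e^\varepsilon\mathbb{P}[M(X')\in S]+\delta$.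
   Formalization: The lower bound is Ω(min(1, rate)), since total variation never exceeds 1 while the stated rate can be arbitrarily large; also d ≥ 2 is assumed (for d = 1 the distance is 0), and ε⁻¹mnd ≥ 2, so that the logarithm is bounded away from 0 (automatic for ε ≤ 1). *)

(* Defs.v *)
From HB Require Import structures.
From mathcomp Require Import all_boot all_order all_algebra.
From mathcomp Require Import all_classical all_reals all_analysis.

Set Implicit Arguments.
Unset Strict Implicit.
Unset Printing Implicit Defensive.

Import Order.TTheory GRing.Theory Num.Theory.

Local Open Scope classical_set_scope.
Local Open Scope ring_scope.

(* [X i j] is the j-th sample of user i; the domain [d] is encoded as 'I_d. *)
Definition dataset (n m d : nat) : finType := 'M['I_d]_(n, m).

Definition is_distr (R : realType) (d : nat) (q : d.-tuple R) : Prop :=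
  (forall k : 'I_d, 0 <= tnth q k) /\ \sum_(k < d) tnth q k = 1.

Definition tv_dist (R : realType) (d : nat) (p q : d.-tuple R) : R :=
  2^-1 * \sum_(k < d) `|tnth p k - tnth q k|.

(* A randomized algorithm maps a dataset to the law of its output, a
   probability measure on R^d with the product of the Borel sigma-algebras.
   Measurability in the input is vacuous because there are finitely many
   datasets. *)
Definition mechanism (R : realType) (n m d : nat) : Type :=
  dataset n m d -> probability (d.-tuple R) R.

Definition outputs_distr (R : realType) (n m d : nat)
    (M : mechanism R n m d) : Prop :=
  forall X : dataset n m d, M X [set q | is_distr q] = 1%E.

Definition neighboring (n m d : nat) (X X' : dataset n m d) : Prop :=
  exists i : 'I_n, forall i' : 'I_n, i' != i ->
    forall j : 'I_m, X i' j = X' i' j.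

Definition user_level_dp (R : realType) (n m d : nat) (eps delta : R)
    (M : mechanism R n m d) : Prop :=
  forall X X' : dataset n m d, neighboring X X' ->
  forall S : set (d.-tuple R), measurable S ->
    (M X S <= (expR eps)%:E * M X' S + delta%:E)%E.

(* Probability of the dataset X when all its entries are i.i.d. from p. *)
Definition iid_pmf (R : realType) (n m d : nat) (p : d.-tuple R)
    (X : dataset n m d) : R :=
  \prod_(i < n) \prod_(j < m) tnth p (X i j).

(* Probability, over the i.i.d. samples from p and the internal randomness of
   M (independent of the samples), that the output of M lies in S. *)
Definition iid_output_prob (R : realType) (n m d : nat)
    (M : mechanism R n m d) (p : d.-tuple R) (S : set (d.-tuple R)) : \bar R :=
  (\sum_(X : dataset n m d) (iid_pmf p X)%:E * M X S)%E.

Definition log_factor (R : realType) (n m d : nat) (eps : R) : R :=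
  ln (eps^-1 * m%:R * n%:R * d%:R).

Definition delta_scale (R : realType) (n m d : nat) (eps : R) : R :=
  eps / (d%:R `^ (3 / 2) * m%:R * n%:R `^ (1 / 2)
         * log_factor n m d eps ^+ 2).

Definition error_rate (R : realType) (n m d : nat) (eps : R) : R :=
  Num.sqrt (d%:R / (m%:R * n%:R))
  + d%:R / (eps * n%:R * Num.sqrt m%:R * log_factor n m d eps ^+ 7).

(* Main.v *)
Require Import Defs.
From HB Require Import structures.
From mathcomp Require Import all_boot all_order all_algebra.
From mathcomp Require Import all_classical all_reals all_analysis.
From mathcomp Require Import measurable_realfun ring lra zify.

Set Implicit Arguments.
Unset Strict Implicit.
Unset Printing Implicit Defensive.

Import Order.TTheory GRing.Theory Num.Theory.

Local Open Scope classical_set_scope.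
Local Open Scope ring_scope.

(** Perturb the uniform law along [d/2] disjoint pairs of atoms by random
    relative amounts [g * u_k], and keep only the signs [T_k] of the differences
    of the output on each pair. Accuracy correlates [T_k] with [u_k], and
    integration by parts in [u_k] (a fingerprinting identity) turns this into a
    correlation of size [d / g] between the [T_k] and the scores of the samples.
    The score of the whole data set in direction [k] has size [sqrt(mn/d)], which
    bounds [g] below by a multiple of [sqrt(d/(mn))]. For the private term,
    a combination of the scores of a single user is a sum of [m] independent
    bounded centered variables once that user is resampled, so privacy limits
    its correlation with the output to [O(eps * sqrt m)]; summing over users
    bounds [g] below by a multiple of [d/(eps n sqrt m)], without logarithms.
    The prior on [u_k] is uniform on a fine grid, so everything is a finite
    sum, up to a discretization error that vanishes with the mesh. *)

(** * Real inequalities and summation by parts *)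

(** From [expR (- y) >= 1 - y] one gets [expR y <= 1 / (1 - y)], and [(1 + y + 2 y^2) (1 - y) = 1 +
    y^2 (1 - 2 y)] is at least 1. *)
Lemma expR_le_quad (R : realType) (y : R) :
  y <= 2^-1 -> expR y <= 1 + y + 2 * y ^+ 2.
Proof.
move=> y2; have h := expR_ge1Dx (- y); have e0 := expR_gt0 y.
have e1 : expR y * expR (- y) = 1 by rewrite -expRD subrr expR0.
have h1 : expR y * (1 - y) <= 1 by rewrite -[leRHS]e1 ler_wpM2l ?expR_ge0.
have y1 : 0 < 1 - y by lra.
rewrite -(ler_pM2r y1); apply: le_trans h1 _.
have := sqr_ge0 y; rewrite expr2 => y0; nra.
Qed.

Lemma norm_le_expRD (R : realType) (y : R) : `|y| <= expR y + expR (- y).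
Proof.
have := expR_ge1Dx y; have := expR_ge1Dx (- y).
have := expR_gt0 y; have := expR_gt0 (- y).
by case: (ger0P y) => ? ? ? ? ?; lra.
Qed.

(** Each new factor at most doubles the error and adds [h^2] times a sum of at most [r <= 3^r]
    terms, hence the factor 3 per step. The exponential constant is harmless: later [#|I|] is fixed
    while the mesh [h] shrinks. *)
Lemma prod1Dh_linear_error (R : realType) (I : finType) (s : I -> R) (h : R) :
  0 <= h <= 1 -> (forall i, `|s i| <= 1) ->
  `|\prod_i (1 + h * s i) - 1 - h * \sum_i s i| <= 3 ^+ #|I| * h ^+ 2.
Proof.
move=> /andP[h0 h1] s1; rewrite cardE -!big_enum /=.
elim: (enum _) => [|i r IHr].
  by rewrite !big_nil /= mulr0 subrr subr0 normr0 mulr_ge0 ?exprn_ge0.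
rewrite !big_cons /= exprS.
set P := \prod_(j <- r) _ in IHr *; set S := \sum_(j <- r) _ in IHr *.
have S1 : `|S| <= (size r)%:R.
  apply: le_trans (ler_norm_sum _ _ _) _.
  by rewrite -sum1_size natr_sum ler_sum.
have r3 : (size r)%:R <= 3 ^+ size r :> R.
  by rewrite -natrX ler_nat ltnW // ltn_expl.
have -> : (1 + h * s i) * P - 1 - h * (s i + S) =
  (1 + h * s i) * (P - 1 - h * S) + h ^+ 2 * (s i * S) by ring.
apply: le_trans (ler_normD _ _) _; rewrite (normrM _ (_ - h * S)).
rewrite (normrM (h ^+ 2)) (normrM (s i)) (ger0_norm (sqr_ge0 h)).
have a1 : `|1 + h * s i| <= 2.
  apply: le_trans (ler_normD _ _) _; rewrite normr1 normrM ger0_norm //.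
  have := s1 i; have := normr_ge0 (s i); nra.
have b1 : `|s i| * `|S| <= 3 ^+ size r.
  apply: le_trans (_ : 1 * (size r)%:R <= _); last by rewrite mul1r.
  exact: ler_pM.
have c1 := ler_pM (normr_ge0 _) (normr_ge0 _) a1 IHr.
have d1 := ler_wpM2l (sqr_ge0 h) b1.
apply: le_trans (lerD c1 d1) _; rewrite le_eqVlt; apply/orP; left.
by apply/eqP; ring.
Qed.

Lemma sum_centered_squares (R : realType) (N : nat) :
  (0 < N)%N ->
  \sum_(t < N.+1) (2 * t%:R / N%:R - 1) ^+ 2 = (N.+1 * N.+2)%:R / (3 * N)%:R :> R.
Proof.
move=> N0; have N0' : N%:R != 0 :> R by rewrite pnatr_eq0 -lt0n.
(* The number of terms is decoupled from the mesh [N] so that induction applies. *)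
have H M : \sum_(t < M.+1) (2 * t%:R / N%:R - 1) ^+ 2 =
    M.+1%:R * (4 * M%:R * (2 * M%:R + 1) / 6 / N%:R ^+ 2 - 2 * M%:R / N%:R + 1) :> R.
  elim: M => [|M IH]; first by rewrite big_ord1 /=; ring.
  rewrite big_ord_recr IH /= -!natr1.
  by field.
rewrite H natrM [in RHS]natrM -!natr1; field.
by rewrite N0'.
Qed.

(* Telescoping against the weights [(t + 1) * (N - t)], whose differences are
   proportional to the grid points. *)
Lemma grid_summation_by_parts (R : realType) (N : nat) (g : nat -> R) :
  (0 < N)%N ->
  \sum_(t < N.+1) (2 * t%:R / N%:R - 1) * g t =
  \sum_(t < N.+1) t.+1%:R * (N%:R - t%:R) / N%:R * (g t.+1 - g t).
Proof.
move=> N0; have N0' : N%:R != 0 :> R by rewrite pnatr_eq0 -lt0n.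
(* The partial sums telescope to a boundary term, which vanishes at [M = N + 1]. The value [g N.+1]
   lies off the grid but carries the weight [N - N = 0]. *)
have H M : \sum_(t < M) ((2 * t%:R / N%:R - 1) * g t -
      t.+1%:R * (N%:R - t%:R) / N%:R * (g t.+1 - g t)) =
    - (M%:R * (N%:R - M%:R + 1) / N%:R * g M).
  elim: M => [|M IH]; first by rewrite big_ord0; ring.
  by rewrite big_ord_recr IH /= -!natr1; field.
apply/eqP; rewrite -subr_eq0 -sumrB H -natr1.
by apply/eqP; rewrite opprD addrA subrr sub0r addNr mulr0 mul0r mul0r oppr0.
Qed.

(** * Product distributions and resampling *)

Definition is_pmf (R : realType) (T : finType) (p : T -> R) : Prop :=
  (forall x, 0 <= p x) /\ \sum_x p x = 1.

Definition prod_pmf (R : realType) (I T : finType) (p : T -> R)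
    (X : {ffun I -> T}) : R := \prod_i p (X i).

Definition upd (I T : finType) (X : {ffun I -> T}) (i : I) (x : T) :
  {ffun I -> T} := [ffun a => if a == i then x else X a].

Lemma is_pmf_prod (R : realType) (I T : finType) (p : T -> R) :
  is_pmf p -> is_pmf (@prod_pmf R I T p).
Proof.
move=> [p0 p1]; split=> [X|]; first exact: prodr_ge0.
by rewrite /prod_pmf -(bigA_distr_bigA (fun _ => p)) p1 prodr_const expr1n.
Qed.

(** Independence factors the moment generating function. Bounds have the form [expR c] on both sides
    so that the lemma iterates: first over the samples of a user, then over users. *)
Lemma prod_pmf_mgf_le (R : realType) (I T : finType) (p Y : T -> R) (c : R) :
  is_pmf p -> \sum_x p x * expR (Y x) <= expR c ->
  \sum_(X : {ffun I -> T}) prod_pmf p X * expR (\sum_i Y (X i)) <=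
    expR (#|I|%:R * c).
Proof.
move=> [p0 p1] Yc; rewrite expRM_natl.
have -> : \sum_(X : {ffun I -> T}) prod_pmf p X * expR (\sum_i Y (X i)) =
    (\sum_x p x * expR (Y x)) ^+ #|I|.
  rewrite -prodr_const (bigA_distr_bigA (fun _ x => p x * expR (Y x))).
  by apply: eq_bigr => X _; rewrite expR_sum -big_split.
by apply: lerXn2r; rewrite // nnegrE ?expR_ge0 // sumr_ge0 // => x _;
  rewrite mulr_ge0 ?expR_ge0.
Qed.

Lemma prod_pmf_mean0 (R : realType) (I T : finType) (p Y : T -> R) :
  \sum_x p x * Y x = 0 ->
  \sum_(X : {ffun I -> T}) prod_pmf p X * (\sum_i Y (X i)) = 0.
Proof.
move=> Y0; under eq_bigr do rewrite mulr_sumr.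
rewrite exchange_big big1 //= => i _.
pose F j x := p x * (if j == i then Y x else 1).
transitivity (\sum_(X : {ffun I -> T}) \prod_j F j (X j)).
  apply: eq_bigr => X _; rewrite /F big_split /= /prod_pmf; congr (_ * _).
  by rewrite -big_mkcond big_pred1_eq.
rewrite -(bigA_distr_bigA F) (bigD1 i) //= /F eqxx Y0 mul0r //.
Qed.

(** A Bernstein bound: the quadratic estimate of [expR] is averaged, and centering kills the linear
    term. *)
Lemma pmf_mgf_le (R : realType) (T : finType) (p Y : T -> R) (v : R) :
  is_pmf p -> \sum_x p x * Y x = 0 -> (forall x, `|Y x| <= 2^-1) ->
  \sum_x p x * Y x ^+ 2 <= v -> \sum_x p x * expR (Y x) <= expR (2 * v).
Proof.
move=> [p0 p1] Y0 Y1 Yv; apply: le_trans (expR_ge1Dx _).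
apply: le_trans (_ : \sum_x (p x + p x * Y x + 2 * (p x * Y x ^+ 2)) <= _).
  apply: ler_sum => x _.
  have := expR_le_quad (le_trans (ler_norm _) (Y1 x)).
  move=> /(ler_wpM2l (p0 x)); lra.
by rewrite !big_split /= p1 Y0 addr0 -mulr_sumr; lra.
Qed.

Lemma pmf_mean_abs_le (R : realType) (T : finType) (p Z : T -> R) (l c : R) :
  (forall x, 0 <= p x) -> 0 < l ->
  \sum_x p x * expR (l * Z x) <= c -> \sum_x p x * expR (- (l * Z x)) <= c ->
  \sum_x p x * `|Z x| <= 2 * c / l.
Proof.
move=> p0 l0 h1 h2; rewrite ler_pdivlMr // mulr_suml.
apply: le_trans (_ : \sum_x (p x * expR (l * Z x) + p x * expR (- (l * Z x))) <= _).
  apply: ler_sum => x _; rewrite -mulrDr -mulrA ler_wpM2l //.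
  by rewrite -{1}(gtr0_norm l0) -normrM mulrC norm_le_expRD.
by rewrite big_split /=; lra.
Qed.

Section Resampling.
Variables (R : realType) (I T : finType).
Implicit Types (X : {ffun I -> T}) (i : I).

Lemma upd_same X i x : upd X i x i = x.
Proof. by rewrite ffunE eqxx. Qed.

Lemma upd_upd X i x : upd (upd X i x) i (X i) = X.
Proof. by apply/ffunP => a; rewrite !ffunE; case: eqP => [->|]. Qed.

(** Swapping [X i] with an independent fresh draw [x] preserves the joint weight; the product form
    avoids dividing by [p (X i)]. *)
Lemma prod_pmf_upd (p : T -> R) X i x :
  prod_pmf p (upd X i x) * p (X i) = prod_pmf p X * p x.
Proof.
rewrite /prod_pmf (bigD1 i) //= [in RHS](bigD1 i) //= upd_same.
rewrite mulrAC [RHS]mulrAC [p x * _]mulrC; congr (_ * _).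
by apply: eq_bigr => j ji; rewrite ffunE (negPf ji).
Qed.

(* The map [(X, x) |-> (upd X i x, X i)] is an involution. *)
Lemma sum_upd i (F : {ffun I -> T} -> T -> R) :
  \sum_X \sum_x F (upd X i x) (X i) = \sum_X \sum_x F X x.
Proof.
rewrite !pair_big /=.
rewrite [RHS](reindex_inj (h := fun q => (upd q.1 i q.2, q.1 i))) //=.
apply: (can_inj (g := fun q => (upd q.1 i q.2, q.1 i))) => -[X x] /=.
by rewrite upd_upd upd_same.
Qed.

End Resampling.

(** * Consequences of approximate domination *)

Definition dp_dominated (R : realType) (A : finType) (e delta : R)
    (P Q : A -> R) : Prop :=
  forall S : {set A}, \sum_(a in S) P a <= e * \sum_(a in S) Q a + delta.

(** The worst event is [S], where [P] exceeds [e * Q]: outside it the difference is nonpositive, and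
    inside it [f] is at most [B]. *)
Lemma dp_dominated_expectation (R : realType) (A : finType) (e delta : R)
    (P Q f : A -> R) (B : R) :
  dp_dominated e delta P Q -> (forall a, 0 <= f a <= B) -> 0 <= B ->
  \sum_a P a * f a <= e * (\sum_a Q a * f a) + delta * B.
Proof.
move=> PQ f01 B0; pose S := [set a | e * Q a < P a]%SET.
have h : \sum_(a in S) (P a - e * Q a) * B <= delta * B.
  by rewrite -mulr_suml sumrB -mulr_sumr ler_wpM2r // lerBlDl PQ.
rewrite -lerBlDl; apply: le_trans h.
rewrite mulr_sumr -sumrB [leRHS]big_mkcond /=.
apply: ler_sum => a _; rewrite inE; have /andP[f0 f1] := f01 a.
by case: ltP => ?; nra.
Qed.

(** Meant for large [eps]. Only the excess of [f] over [eps / l] is transferred from [P] to [Q];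
    there the factor [expR eps] is absorbed, since [l f - eps <= expR (l f - eps)]. *)
Lemma dp_dominated_tail (R : realType) (A : finType) (e delta : R)
    (P Q f : A -> R) (l eps B : R) :
  dp_dominated e delta P Q -> e = expR eps -> is_pmf P -> (forall a, 0 <= Q a) ->
  0 <= eps -> 0 < l -> (forall a, `|f a| <= B) -> 0 <= B ->
  \sum_a P a * f a <= (eps + \sum_a Q a * expR (l * f a)) / l + delta * B.
Proof.
move=> PQ ee [P0 P1] Q0 eps0 l0 fB B0; have t0 : 0 <= eps / l by rewrite divr_ge0 // ltW.
pose f' a := Num.max 0 (f a - eps / l).
have f'B a : 0 <= f' a <= B.
  rewrite le_max lexx /= ge_max B0 /=.
  by have := fB a; rewrite ler_norml => /andP[_ ?]; lra.
have h := dp_dominated_expectation PQ f'B B0.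
apply: le_trans (_ : \sum_a (P a * (eps / l) + P a * f' a) <= _).
  apply: ler_sum => a _; rewrite -mulrDr ler_wpM2l //.
  by rewrite -lerBlDl le_max lexx orbT.
rewrite big_split /= -mulr_suml P1 mul1r mulrDl -addrA lerD2l.
apply: le_trans h _; rewrite lerD2r mulr_sumr mulr_suml.
apply: ler_sum => a _; rewrite mulrCA -mulrA ler_wpM2l //.
rewrite ler_pdivlMr // ee /f' mulrAC -mulrA -[l in X in X <= _](gtr0_norm l0).
rewrite (_ : _ * f a = eps + (l * f a - eps)); last by ring.
rewrite expRD ler_wpM2l ?expR_ge0 // gtr0_norm //.
rewrite (_ : l * f a - eps = l * (f a - eps / l)); last by field; rewrite gt_eqF.
case: (leP 0 (f a - eps / l)) => _; last by rewrite mulr0 expR_ge0.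
by apply: le_trans (expR_ge1Dx _); rewrite lerDr.
Qed.

(* Splitting f into positive and negative parts keeps the factor [e - 1],
   which is essential when the privacy parameter is small. *)
Lemma dp_dominated_mean (R : realType) (A : finType) (e delta : R)
    (P Q f : A -> R) (B : R) :
  dp_dominated e delta P Q -> dp_dominated e delta Q P -> (forall a, 0 <= Q a) ->
  1 <= e -> 0 <= delta -> (forall a, `|f a| <= B) -> 0 <= B ->
  \sum_a P a * f a <=
    \sum_a Q a * f a + (e - 1) * (\sum_a Q a * `|f a|) + 2 * delta * B.
Proof.
move=> PQ QP Q0 e1 d0 fB B0.
have hp a : 0 <= (`|f a| + f a) / 2 <= B.
  by have := fB a; case: (ger0P (f a)) => ? ?; lra.
have hn a : 0 <= (`|f a| - f a) / 2 <= B.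
  by have := fB a; case: (ger0P (f a)) => ? ?; lra.
have Dp (T : A -> R) : \sum_a T a * ((`|f a| + f a) / 2) =
    (\sum_a T a * `|f a| + \sum_a T a * f a) / 2.
  by rewrite -big_split /= mulr_suml; apply: eq_bigr => a _; ring.
have Dn (T : A -> R) : \sum_a T a * ((`|f a| - f a) / 2) =
    (\sum_a T a * `|f a| - \sum_a T a * f a) / 2.
  by rewrite -sumrB mulr_suml; apply: eq_bigr => a _; ring.
have kp := dp_dominated_expectation PQ hp B0.
have kn := dp_dominated_expectation QP hn B0.
move: kp kn; rewrite !Dp !Dn.
have u0 : 0 <= \sum_a Q a * `|f a| - \sum_a Q a * f a.
  rewrite -sumrB sumr_ge0 // => a _; rewrite -mulrBr mulr_ge0 // subr_ge0.
  exact: ler_norm.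
set u1 := \sum_a Q a * `|f a| in u0 *; set u2 := \sum_a Q a * f a in u0 *.
set w1 := \sum_a P a * `|f a|; set w2 := \sum_a P a * f a => kp kn.
have dB : 0 <= delta * B by rewrite mulr_ge0.
(* The negative part is bounded below with factor [1 / e >= 2 - e], which is [(e - 1)^2 >= 0]; this
   linear form can be combined with the bound [kp]. *)
have : (2 - e) * (u1 - u2) - 2 * delta * B <= w1 - w2.
  rewrite -(@ler_pM2l _ e); last by lra.
  have h1 : 0 <= (e - 1) ^+ 2 * (u1 - u2) by rewrite mulr_ge0 ?sqr_ge0.
  have h2 : 0 <= (e - 1) * (delta * B) by rewrite mulr_ge0 ?subr_ge0.
  by nra.
by lra.
Qed.


(** * Replacing the data of one user *)

Section UserReplacement.
Variables (R : realType) (I U A : finType) (pi : U -> R).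
Variable mu : {ffun I -> U} -> A -> R.
Hypothesis pi_pmf : is_pmf pi.
Hypothesis mu_pmf : forall X, is_pmf (mu X).

(* After the data of user i is resampled, X i is independent of the output. *)
Lemma resampled_expectation (i : I) (G : A -> U -> R) :
  \sum_(X : {ffun I -> U}) \sum_x prod_pmf pi X * pi x *
    (\sum_a mu (upd X i x) a * G a (X i)) =
  \sum_(X : {ffun I -> U}) prod_pmf pi X *
    (\sum_a mu X a * \sum_x pi x * G a x).
Proof.
pose F X x := prod_pmf pi X * pi x * (\sum_a mu X a * G a x).
transitivity (\sum_(X : {ffun I -> U}) \sum_x F (upd X i x) (X i)).
  by apply: eq_bigr => X _; apply: eq_bigr => x _; rewrite /F prod_pmf_upd.
rewrite sum_upd; apply: eq_bigr => X _; rewrite /F.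
under eq_bigr do rewrite -mulrA mulr_sumr.
rewrite -mulr_sumr exchange_big /=; congr (_ * _).
apply: eq_bigr => a _; rewrite mulr_sumr.
by apply: eq_bigr => x _; rewrite mulrCA.
Qed.

Lemma resampled_expectation_le (i : I) (G : A -> U -> R) (c : R) :
  (forall a, \sum_x pi x * G a x <= c) ->
  \sum_(X : {ffun I -> U}) \sum_x prod_pmf pi X * pi x *
    (\sum_a mu (upd X i x) a * G a (X i)) <= c.
Proof.
move=> Gc; rewrite resampled_expectation.
have [P0 P1] := is_pmf_prod I pi_pmf.
rewrite -[leRHS]mul1r -P1 mulr_suml; apply: ler_sum => X _; rewrite ler_wpM2l //.
have [m0 m1] := mu_pmf X.
by rewrite -[leRHS]mul1r -m1 mulr_suml; apply: ler_sum => a _; rewrite ler_wpM2l.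
Qed.

(** Privacy compares the output on [X] with the output after user [i] is resampled, which is
    independent of [X i], so that [Z] then has mean zero. *)
Lemma dp_user_correlation (i : I) (eps delta l B : R) (Z : A -> U -> R) :
  0 < eps -> 0 <= delta -> 0 < l -> 0 <= B ->
  (forall X x, dp_dominated (expR eps) delta (mu X) (mu (upd X i x))) ->
  (forall a, \sum_x pi x * Z a x = 0) ->
  (forall a, \sum_x pi x * expR (l * Z a x) <= 2) ->
  (forall a, \sum_x pi x * expR (- (l * Z a x)) <= 2) ->
  (forall a x, `|Z a x| <= B) ->
  \sum_(X : {ffun I -> U}) prod_pmf pi X * (\sum_a mu X a * Z a (X i)) <=
    8 * eps / l + 2 * delta * B.
Proof.
move=> eps0 d0 l0 B0 dp Z0 Zp Zn ZB.
have [pi0 pi1] := pi_pmf; have [P0 P1] := is_pmf_prod I pi_pmf.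
have -> : \sum_(X : {ffun I -> U}) prod_pmf pi X * (\sum_a mu X a * Z a (X i)) =
    \sum_(X : {ffun I -> U}) \sum_x prod_pmf pi X * pi x *
      (\sum_a mu X a * Z a (X i)).
  by apply: eq_bigr => X _; rewrite -mulr_suml -mulr_sumr pi1 mulr1.
have W (X : {ffun I -> U}) x : 0 <= prod_pmf pi X * pi x by exact: mulr_ge0.
have cst c : \sum_(X : {ffun I -> U}) \sum_x prod_pmf pi X * pi x * c = c.
  under eq_bigr do rewrite -mulr_suml -mulr_sumr pi1 mulr1.
  by rewrite -mulr_suml P1 mul1r.
have dB : 0 <= delta * B by rewrite mulr_ge0.
(* For small [eps] the correlation costs [expR eps - 1 <= 2 eps] times a mean of [|Z|], at most
   [4 / l]. For large [eps] the tail bound gives [(eps + 2) / l <= 5 eps / l]. *)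
have [eps_le|eps_gt] := lerP eps 2^-1.
  have e1 : 1 <= expR eps by rewrite -expR0 ler_expR ltW.
  have e2 : expR eps - 1 <= 2 * eps by have := expR_le_quad eps_le; nra.
  apply: le_trans (_ : \sum_(X : {ffun I -> U}) \sum_x prod_pmf pi X * pi x *
      ((\sum_a mu (upd X i x) a * Z a (X i)) +
       (expR eps - 1) * (\sum_a mu (upd X i x) a * `|Z a (X i)|) +
       2 * delta * B) <= _).
    apply: ler_sum => X _; apply: ler_sum => x _; rewrite ler_wpM2l //.
    apply: dp_dominated_mean => //.
      by have := dp (upd X i x) (X i); rewrite upd_upd.
    by move=> a; case: (mu_pmf (upd X i x)).
  under eq_bigr => X _ do
    (under eq_bigr => x _ do rewrite !mulrDr (mulrCA _ (expR eps - 1));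
     rewrite !big_split /= -mulr_sumr).
  rewrite !big_split /= -mulr_sumr cst lerD2r.
  have -> : 8 * eps / l = 0 + (2 * eps) * (4 / l) by field; rewrite gt_eqF.
  apply: lerD; first by apply: resampled_expectation_le => a; rewrite Z0.
  apply: ler_pM => //; first by rewrite subr_ge0.
    apply: sumr_ge0 => X _; apply: sumr_ge0 => x _; rewrite mulr_ge0 //.
    by apply: sumr_ge0 => a _; rewrite mulr_ge0 //; case: (mu_pmf (upd X i x)).
  apply: (@resampled_expectation_le i (fun a x => `|Z a x|)) => a.
  by apply: le_trans (pmf_mean_abs_le pi0 l0 (Zp a) (Zn a)) _; rewrite -natrM.
apply: le_trans (_ : \sum_(X : {ffun I -> U}) \sum_x prod_pmf pi X * pi x *
    ((eps + \sum_a mu (upd X i x) a * expR (l * Z a (X i))) / l +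
     delta * B) <= _).
  apply: ler_sum => X _; apply: ler_sum => x _; rewrite ler_wpM2l //.
  apply: (dp_dominated_tail (dp X x) erefl) => //; last exact: ltW.
  by move=> a; case: (mu_pmf (upd X i x)).
under eq_bigr => X _ do
  (under eq_bigr => x _ do
     rewrite mulrDl addrAC (mulrC eps) (mulrC _ l^-1) mulrDr (mulrCA _ l^-1);
   rewrite !big_split /= -mulr_sumr).
rewrite !big_split /= -mulr_sumr cst.
apply: le_trans (_ : l^-1 * eps + delta * B + l^-1 * 2 <= _); last first.
  have : 5 * eps / l <= 8 * eps / l by rewrite ler_pM2r ?invr_gt0; lra.
  have : (eps + 2) / l <= (5 * eps) / l by rewrite ler_pM2r ?invr_gt0; lra.
  by lra.
rewrite lerD2l ler_pM2l ?invr_gt0 //.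
exact: (@resampled_expectation_le i (fun a x => expR (l * Z a x))).
Qed.

End UserReplacement.

(** * Perturbations of the uniform distribution *)

(** Allows a sum over all parameters to be estimated one coordinate at a time, the others being
    frozen. *)
Lemma sum_upd_coord (R : realType) (I T : finType) (i : I)
    (F : {ffun I -> T} -> R) :
  \sum_X \sum_x F (upd X i x) = #|T|%:R * \sum_X F X.
Proof.
rewrite (sum_upd i (fun X _ => F X)) mulr_sumr.
by apply: eq_bigr => X _; rewrite sumr_const mulr_natl.
Qed.

Lemma sum_indicator (R : realType) (T : finType) (F : T -> R) (y : T) :
  \sum_x F x * (x == y)%:R = F y.
Proof.
rewrite (bigD1 y) //= eqxx mulr1 big1 ?addr0 // => x /negPf ->.
by rewrite mulr0.
Qed.

Lemma sum_indicator1 (R : realType) (T : finType) (y : T) :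
  \sum_x (x == y)%:R = 1 :> R.
Proof.
rewrite -[RHS](sum_indicator (fun=> 1) y).
by apply: eq_bigr => x _; rewrite mul1r.
Qed.

Section PerturbedUniform.
Variables (R : realType) (d : nat).
Local Notation K := d./2.

Lemma lo_subproof (k : 'I_K) : (k < d)%N.
Proof. by have := ltn_ord k; have := odd_double_half d; lia. Qed.

Lemma hi_subproof (k : 'I_K) : (K + k < d)%N.
Proof. by have := ltn_ord k; have := odd_double_half d; lia. Qed.

(** Pair [k] consists of the atoms [k] and [K + k]; for odd [d] the last atom stays unpaired. *)
Definition lo (k : 'I_K) : 'I_d := Ordinal (lo_subproof k).
Definition hi (k : 'I_K) : 'I_d := Ordinal (hi_subproof k).

Definition direction (k : 'I_K) (x : 'I_d) : R := (x == lo k)%:R - (x == hi k)%:R.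

Lemma sum_direction (F : 'I_d -> R) (k : 'I_K) :
  \sum_x F x * direction k x = F (lo k) - F (hi k).
Proof.
by under eq_bigr do rewrite mulrBr; rewrite sumrB !sum_indicator.
Qed.

Lemma norm_direction_le (k : 'I_K) x :
  `|direction k x| <= (x == lo k)%:R + (x == hi k)%:R.
Proof. by apply: le_trans (ler_normB _ _) _; rewrite !normr_nat. Qed.

Lemma sum_norm_direction_l1 (k : 'I_K) : \sum_x `|direction k x| <= 2.
Proof.
apply: le_trans (ler_sum _ (fun x _ => norm_direction_le k x)) _.
by rewrite big_split /= !sum_indicator1.
Qed.

Lemma sum_lo_hi_indicator_le1 (x : 'I_d) :
  \sum_k ((x == lo k)%:R + (x == hi k)%:R) <= 1 :> R.
Proof.
rewrite big_split /=.
have [xK|Kx] := ltnP x K.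
  rewrite [X in _ + X]big1 ?addr0 => [|k _]; last first.
    by rewrite -val_eqE /=; case: eqP => // xk; lia.
  rewrite (eq_bigr (fun k => (k == Ordinal xK)%:R)) ?sum_indicator1 // => k _.
  by rewrite -!val_eqE /=; congr (_%:R); lia.
rewrite big1 ?add0r => [|k _]; last first.
  by rewrite -val_eqE /=; case: eqP => // xk; have := ltn_ord k; lia.
have [xK|K2x] := ltnP (x - K) K.
  rewrite (eq_bigr (fun k => (k == Ordinal xK)%:R)) ?sum_indicator1 // => k _.
  by rewrite -!val_eqE /=; congr (_%:R); lia.
(* Only the unpaired last atom of an odd [d] reaches this case. *)
rewrite big1 ?ler01 // => k _.
by rewrite -val_eqE /=; case: eqP => // xk; have := ltn_ord k; lia.
Qed.

Lemma sum_norm_direction_le1 (x : 'I_d) : \sum_k `|direction k x| <= 1.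
Proof.
apply: le_trans (ler_sum _ (fun k _ => norm_direction_le k x)) _.
exact: sum_lo_hi_indicator_le1.
Qed.

Lemma sum_lo_hi_le (F : 'I_d -> R) : (forall x, 0 <= F x) ->
  \sum_k (F (lo k) + F (hi k)) <= \sum_x F x.
Proof.
move=> F0; apply: le_trans
  (_ : \sum_x F x * \sum_k ((x == lo k)%:R + (x == hi k)%:R) <= _).
  under [leRHS]eq_bigr do rewrite mulr_sumr.
  rewrite exchange_big /=; apply: ler_sum => k _.
  by under eq_bigr do rewrite mulrDr; rewrite big_split !sum_indicator.
by apply: ler_sum => x _; rewrite ler_piMr // sum_lo_hi_indicator_le1.
Qed.

Lemma norm_direction_le1 k x : `|direction k x| <= 1.
Proof.
apply: le_trans (sum_norm_direction_le1 x).
by rewrite (bigD1 k) //= lerDl sumr_ge0.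
Qed.

Definition tilt (g : R) (u : 'I_K -> R) (x : 'I_d) : R :=
  1 + g * \sum_k u k * direction k x.

Lemma tilt_lo (g : R) (u : 'I_K -> R) k : tilt g u (lo k) = 1 + g * u k.
Proof.
rewrite /tilt -(sum_indicator u k); congr (_ + _ * _); apply: eq_bigr => l _.
rewrite /direction -!val_eqE /= (_ : (_ == K + l)%N = false) ?subr0 1?eq_sym //.
by have := ltn_ord k; lia.
Qed.

Lemma tilt_hi (g : R) (u : 'I_K -> R) k : tilt g u (hi k) = 1 - g * u k.
Proof.
rewrite /tilt -mulrN -(sum_indicator (fun l => - u l) k).
congr (_ + _ * _); apply: eq_bigr => l _; rewrite mulNr -mulrN.
rewrite /direction -!val_eqE /= (_ : (_ == l :> nat) = false) ?sub0r.
  by rewrite eqn_add2l eq_sym.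
by have := ltn_ord l; lia.
Qed.

Definition perturbed (g : R) (u : 'I_K -> R) (x : 'I_d) : R := tilt g u x / d%:R.

(** [g * score] is the derivative of the logarithm of [perturbed] in the coordinate [u k]; the
    factor [g] is kept outside. *)
Definition score (g : R) (u : 'I_K -> R) (k : 'I_K) (x : 'I_d) : R :=
  direction k x / tilt g u x.

Definition shift (u : 'I_K -> R) (k : 'I_K) (h : R) (l : 'I_K) : R :=
  if l == k then u l + h else u l.

Variables (g : R) (u : 'I_K -> R).
Hypotheses (d0 : (0 < d)%N) (g01 : 0 <= g <= 2^-1) (u1 : forall k, `|u k| <= 1).

Lemma tilt_ge x : 2^-1 <= tilt g u x.
Proof.
have h : `|\sum_k u k * direction k x| <= 1.
  apply: le_trans (ler_norm_sum _ _ _) _.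
  apply: le_trans (sum_norm_direction_le1 x); apply: ler_sum => k _.
  by rewrite normrM ler_piMl.
have /andP[g0 g1] := g01; rewrite /tilt.
by move: h; rewrite ler_norml => /andP[h1 h2]; nra.
Qed.

Lemma tilt_gt0 x : 0 < tilt g u x.
Proof. by apply: lt_le_trans (tilt_ge x); rewrite invr_gt0. Qed.

Let dR0 : 0 < d%:R :> R. Proof. by rewrite ltr0n. Qed.

Lemma perturbed_pmf : is_pmf (perturbed g u).
Proof.
split=> [x|]; first by rewrite divr_ge0 // ltW // tilt_gt0.
rewrite -mulr_suml /tilt big_split /= sumr_const card_ord -mulr_sumr exchange_big.
rewrite [X in _ + g * X]big1 => [|k _].
  by rewrite mulr0 addr0 divff // gt_eqF.
by rewrite (sum_direction (fun=> u k)) subrr.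
Qed.

Lemma perturbed_score k x :
  perturbed g u x * score g u k x = direction k x / d%:R.
Proof.
rewrite /perturbed /score; field.
by rewrite (gt_eqF (tilt_gt0 x)) gt_eqF.
Qed.

Lemma score_mean0 k : \sum_x perturbed g u x * score g u k x = 0.
Proof.
under eq_bigr do rewrite perturbed_score mulrC.
by rewrite (sum_direction (fun=> d%:R^-1)) subrr.
Qed.

Lemma norm_score_le k x : `|score g u k x| <= 2 * `|direction k x|.
Proof.
rewrite normrM mulrC ler_wpM2r // normfV gtr0_norm ?tilt_gt0 //.
by rewrite invf_ple ?posrE ?tilt_gt0 // tilt_ge.
Qed.

Lemma norm_score_le2 k x : `|score g u k x| <= 2.
Proof.
apply: le_trans (norm_score_le k x) _.
by rewrite -[leRHS]mulr1 ler_wpM2l // norm_direction_le1.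
Qed.

Lemma sum_norm_score_le2 x : \sum_k `|score g u k x| <= 2.
Proof.
apply: le_trans (ler_sum _ (fun k _ => norm_score_le k x)) _.
by rewrite -mulr_sumr -[leRHS]mulr1 ler_wpM2l // sum_norm_direction_le1.
Qed.

(** The score is bounded and lives on two atoms, each of mass of order [1 / d]. *)
Lemma score_variance k :
  \sum_x perturbed g u x * score g u k x ^+ 2 <= 4 / d%:R.
Proof.
apply: le_trans (_ : \sum_x (2 / d%:R) * `|direction k x| <= _); last first.
  rewrite -mulr_sumr (_ : 4 / d%:R = 2 / d%:R * 2); last by ring.
  by rewrite ler_wpM2l ?sum_norm_direction_l1 // divr_ge0.
apply: ler_sum => x _; rewrite expr2 mulrA perturbed_score.
rewrite [leLHS]mulrAC [leRHS]mulrAC ler_wpM2r ?invr_ge0 //.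
apply: le_trans (ler_norm _) _; rewrite normrM mulrC ler_pM //.
exact: norm_score_le2.
Qed.

(** The density is affine in each [u k], so the first-order expansion has no remainder for a single
    sample. *)
Lemma perturbed_shift k h x :
  perturbed g (shift u k h) x =
  perturbed g u x * (1 + h * (g * score g u k x)).
Proof.
have t0 := tilt_gt0 x.
have -> : perturbed g (shift u k h) x =
    (tilt g u x + h * (g * direction k x)) / d%:R.
  congr (_ / _); rewrite /tilt -addrA; congr (_ + _).
  rewrite mulrCA -mulrDr; congr (_ * _).
  rewrite (bigD1 k) //= [in RHS](bigD1 k) //= /shift eqxx mulrDl -!addrA.
  congr (_ + _); rewrite addrC; congr (_ + _).
  by apply: eq_bigr => l /negPf ->.
rewrite /perturbed /score; field.
by rewrite (gt_eqF t0) gt_eqF.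
Qed.

End PerturbedUniform.

(** * The fingerprinting identity *)

Definition sample (n m d : nat) : Type := {ffun 'I_n -> {ffun 'I_m -> 'I_d}}.

Definition lik (R : realType) (n m d : nat) (g : R) (u : 'I_(d./2) -> R)
    (X : sample n m d) : R := prod_pmf (prod_pmf (perturbed g u)) X.

Definition total_score (R : realType) (n m d : nat) (g : R) (u : 'I_(d./2) -> R)
    (k : 'I_(d./2)) (X : sample n m d) : R :=
  \sum_i \sum_j score g u k (X i j).

Definition grid (R : realType) (N t : nat) : R := 2 * t%:R / N%:R - 1.

(** Discrete analogue of [(1 - u^2) / 2], the weight that integration by parts against the uniform
    law on [-1, 1] produces. *)
Definition grid_weight (R : realType) (N t : nat) : R :=
  2 * t.+1%:R * (N%:R - t%:R) / N%:R ^+ 2.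

Lemma grid_norm_le1 (R : realType) (N : nat) (t : 'I_N.+1) :
  `|grid R N t| <= 1.
Proof.
rewrite /grid; have [N0|N0] := posnP N.
  (* Division by zero yields 0, so the degenerate grid is the point -1. *)
  have -> : N%:R = 0 :> R by rewrite N0.
  by rewrite invr0 mulr0 sub0r normrN1.
have N0' : 0 < N%:R :> R by rewrite ltr0n.
have tN : t%:R <= N%:R :> R by rewrite ler_nat -ltnS.
have : 0 <= t%:R / N%:R :> R by rewrite divr_ge0.
have : t%:R / N%:R <= 1 :> R by rewrite ler_pdivrMr // mul1r.
by rewrite ler_norml -mulrA => ? ?; apply/andP; split; lra.
Qed.

Lemma grid_weight_bounds (R : realType) (N : nat) (t : 'I_N.+1) :
  (0 < N)%N -> 0 <= grid_weight R N t <= 2.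
Proof.
move=> N0; have N0' : 0 < N%:R :> R by rewrite ltr0n.
have tN : (t <= N)%N by rewrite -ltnS.
have tN' : t%:R <= N%:R :> R by rewrite ler_nat.
rewrite /grid_weight -(natrB _ tN) divr_ge0 ?exprn_ge0 ?mulr_ge0 //=.
rewrite ler_pdivrMr ?exprn_gt0 // -mulrA ler_wpM2l //.
rewrite -natrX -natrM ler_nat expnS expn1.
by move: tN; rewrite leq_eqVlt => /orP[/eqP ->|tN]; nia.
Qed.

Section ParameterGrid.
Variables (R : realType) (d N : nat).
Local Notation K := d./2.

Definition param := {ffun 'I_K -> 'I_N.+1}.

Definition upar (th : param) (k : 'I_K) : R := grid R N (th k).

Lemma upar_norm_le1 th k : `|upar th k| <= 1.
Proof. exact: grid_norm_le1. Qed.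

(** Since [|u| <= 1], [|u|] dominates [u^2], whose mean over the grid is
    [(N + 2) / (3 N) >= 1 / 3]. *)
Lemma sum_upar_norm_ge : (1 < N)%N ->
  #|{: param}|%:R * (K%:R / 3) <= \sum_(th : param) \sum_k `|upar th k|.
Proof.
move=> N1; have N0 : (0 < N)%N by apply: ltn_trans N1.
have N0' : 0 < N%:R :> R by rewrite ltr0n.
rewrite exchange_big /= -[X in X%:R / 3]card_ord.
rewrite mulrA -natrM mulnC natrM -mulrA mulr_natl -sumr_const.
apply: ler_sum => k _.
rewrite -(@ler_pM2l _ #|{: 'I_N.+1}|%:R); last by rewrite card_ord ltr0n.
rewrite -(sum_upd_coord k) mulrCA mulr_natl -sumr_const; apply: ler_sum => th _.
apply: le_trans (_ : \sum_(t < N.+1) grid R N t ^+ 2 <= _); last first.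
  apply: ler_sum => t _; rewrite /upar upd_same -real_normK ?num_real // expr2.
  by rewrite ler_piMl // grid_norm_le1.
rewrite sum_centered_squares // card_ord ler_pdivrMr // mulrAC ler_pdivlMr.
  by rewrite -!natrM ler_nat; lia.
by rewrite ltr0n; lia.
Qed.

End ParameterGrid.

Section Fingerprint.
Variables (R : realType) (n m d N : nat) (g : R).
Local Notation K := d./2.
Variable tau : 'I_K -> sample n m d -> R.
Hypotheses (d0 : (0 < d)%N) (g01 : 0 <= g <= 2^-1) (N1 : (1 < N)%N).
Hypothesis tau1 : forall k X, `|tau k X| <= 1.

Lemma lik_pmf (u : 'I_K -> R) :
  (forall k, `|u k| <= 1) -> is_pmf (@lik R n m d g u).
Proof. by move=> u1; do 2! apply: is_pmf_prod; apply: perturbed_pmf. Qed.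

Lemma lik_shift (u : 'I_K -> R) k h (X : sample n m d) :
  (forall k, `|u k| <= 1) ->
  lik g (shift u k h) X =
  lik g u X * \prod_(q : 'I_n * 'I_m) (1 + h * (g * score g u k (X q.1 q.2))).
Proof.
move=> u1; rewrite -(pair_bigA _ (fun i j => 1 + h * (g * score g u k (X i j)))) /=.
rewrite /lik /prod_pmf -big_split /=; apply: eq_bigr => i _.
by rewrite -big_split /=; apply: eq_bigr => j _; rewrite perturbed_shift.
Qed.

(** The likelihood ratio is a product over the [n * m] samples; its linear term produces the total
    score, and the rest is the error of [prod1Dh_linear_error]. *)
Lemma mean_shift_le (u : 'I_K -> R) k h :
  (forall k, `|u k| <= 1) -> 0 <= h <= 1 ->
  \sum_X lik g (shift u k h) X * tau k X - \sum_X lik g u X * tau k X <=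
  h * (g * \sum_X lik g u X * tau k X * total_score g u k X)
    + 3 ^+ (n * m) * h ^+ 2.
Proof.
move=> u1 h01; have [P0 P1] := lik_pmf u1; have /andP[g0 g1] := g01.
rewrite -lerBlDl.
have -> : \sum_X lik g (shift u k h) X * tau k X - \sum_X lik g u X * tau k X
    - h * (g * \sum_X lik g u X * tau k X * total_score g u k X) =
    \sum_X lik g u X * (tau k X *
      (\prod_(q : 'I_n * 'I_m) (1 + h * (g * score g u k (X q.1 q.2))) - 1 -
       h * \sum_(q : 'I_n * 'I_m) (g * score g u k (X q.1 q.2)))).
  rewrite !mulr_sumr -!sumrB; apply: eq_bigr => X _.
  rewrite lik_shift // /total_score pair_big /= -mulr_sumr; ring.
rewrite -[leRHS]mul1r -[X in _ <= X * _]P1 mulr_suml; apply: ler_sum => X _.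
rewrite ler_wpM2l //; apply: le_trans (ler_norm _) _.
rewrite normrM -[leRHS]mul1r ler_pM //.
rewrite -[X in (X * _)%N]card_ord -[X in (_ * X)%N]card_ord -card_prod.
apply: (@prod1Dh_linear_error _ _ (fun q => g * score g u k (X q.1 q.2))) => // q.
(* Each factor satisfies [|g * score| <= 1], because [g <= 1/2] and [|score| <= 2]. *)
rewrite normrM ger0_norm //.
by have := norm_score_le2 g01 u1 k (X q.1 q.2); nra.
Qed.

(** Summation by parts in coordinate [k], then a first-order expansion of each increment over the
    mesh [2 / N]. The remainder is the weight bound 2 times [3^(n m)] times [2 / N]. *)
Lemma fingerprint_identity :
  \sum_(th : param d N) \sum_k upar R th k *
    (\sum_X lik g (upar R th) X * tau k X) <=
  \sum_(th : param d N)
    (g * (\sum_k grid_weight R N (th k) *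
       \sum_X lik g (upar R th) X * tau k X * total_score g (upar R th) k X)
     + K%:R * (4 * 3 ^+ (n * m) / N%:R)).
Proof.
have N0 : (0 < N)%N by apply: ltn_trans N1.
have N0' : 0 < N%:R :> R by rewrite ltr0n.
rewrite exchange_big /=.
under [leRHS]eq_bigr => th _ do
  rewrite mulr_sumr mulr_natl -[X in _ *+ X]card_ord -sumr_const -big_split /=.
rewrite [leRHS]exchange_big /=; apply: ler_sum => k _.
rewrite -(@ler_pM2l _ #|{: 'I_N.+1}|%:R); last by rewrite card_ord ltr0n.
rewrite -!(sum_upd_coord k); apply: ler_sum => th _.
(* Here [t] ranges over all naturals, since summation by parts also refers to the point [N + 1]. *)
pose v t l : R := if l == k then grid R N t else upar R th l.
have vE (t : 'I_N.+1) : upar R (upd th k t) = v t.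
  by apply: funext => l; rewrite /upar /v ffunE; case: eqP.
have v1 (t : 'I_N.+1) l : `|v t l| <= 1.
  by rewrite -vE upar_norm_le1.
have vS t : v t.+1 = shift (v t) k (2 / N%:R).
  apply: funext => l; rewrite /shift /v; case: eqP => // _.
  by rewrite /grid -natr1; field; rewrite gt_eqF.
under eq_bigr => t _ do rewrite vE {1}/v eqxx.
rewrite (grid_summation_by_parts
  (fun t => \sum_X lik g (v t) X * tau k X) N0).
apply: ler_sum => t _; rewrite vE upd_same vS.
have [w0 w2] := andP (grid_weight_bounds R t N0).
have h01 : 0 <= (2 / N%:R : R) <= 1.
  by apply/andP; split; rewrite ?divr_ge0 // ler_pdivrMr // mul1r ler_nat.
have := mean_shift_le k (v1 t) h01.
have -> : t.+1%:R * (N%:R - t%:R) / N%:R = grid_weight R N t / (2 / N%:R) :> R.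
  by rewrite /grid_weight; field; rewrite gt_eqF.
set D := (X in X <= _); set G := \sum_X _ => DG.
have h0 : 0 < 2 / N%:R :> R by rewrite divr_gt0.
rewrite mulrAC -mulrA.
have Dh : D / (2 / N%:R) <= g * G + 3 ^+ (n * m) * (2 / N%:R).
  rewrite ler_pdivrMr //; apply: le_trans DG _.
  by rewrite le_eqVlt; apply/predU1P; left; ring.
apply: le_trans (ler_wpM2l w0 Dh) _; rewrite mulrDr mulrCA lerD2l.
apply: le_trans (ler_wpM2r _ w2) _; first by rewrite mulr_ge0 ?exprn_ge0 // ltW.
by rewrite le_eqVlt; apply/predU1P; left; ring.
Qed.

End Fingerprint.

(** * Upper bounds on the correlation *)

Section CorrelationBounds.
Variables (R : realType) (n m d : nat) (g : R) (u : 'I_(d./2) -> R).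
Local Notation K := d./2.
Hypotheses (d0 : (0 < d)%N) (m0 : (0 < m)%N) (g01 : 0 <= g <= 2^-1).
Hypothesis u1 : forall k, `|u k| <= 1.

Lemma expR_half_le2 (x : R) : x <= 2^-1 -> expR x <= 2.
Proof.
move=> x2; have h : expR x <= expR 2^-1 by rewrite ler_expR.
by apply: le_trans h _; apply: le_trans (expR_le_quad (lexx _)) _; lra.
Qed.

(** With variance at most [4 / d] per sample, the exponent is at most [8 n m l^2 / d <= 1/2]. *)
Lemma total_score_mgf_le (l : R) (k : 'I_K) :
  `|l| <= 4^-1 -> (n * m)%:R * l ^+ 2 <= d%:R / 16 ->
  \sum_(X : sample n m d) lik g u X * expR (l * total_score g u k X) <= 2.
Proof.
move=> l4 l2; have pp := perturbed_pmf d0 g01 u1.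
have dR0 : 0 < d%:R :> R by rewrite ltr0n.
pose Y x := l * score g u k x.
have Y0 : \sum_x perturbed g u x * Y x = 0.
  under eq_bigr do rewrite mulrCA.
  by rewrite -mulr_sumr score_mean0 ?mulr0.
have Y1 x : `|Y x| <= 2^-1.
  rewrite normrM; have := norm_score_le2 g01 u1 k x.
  by have := normr_ge0 (score g u k x); nra.
have Y2 : \sum_x perturbed g u x * Y x ^+ 2 <= l ^+ 2 * (4 / d%:R).
  under eq_bigr do rewrite exprMn mulrCA.
  by rewrite -mulr_sumr ler_wpM2l ?sqr_ge0 // score_variance.
have h1 := prod_pmf_mgf_le 'I_m pp (pmf_mgf_le pp Y0 Y1 Y2).
have h2 := prod_pmf_mgf_le 'I_n (is_pmf_prod _ pp) h1.
apply: le_trans (le_trans h2 _); last first.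
  apply: expR_half_le2; rewrite !card_ord mulrA -natrM.
  rewrite (_ : _ * _ = (n * m)%:R * l ^+ 2 * (8 / d%:R)); last by ring.
  apply: le_trans (ler_wpM2r _ l2) _; first by rewrite divr_ge0 // ltW.
  by rewrite le_eqVlt; apply/predU1P; left; field; rewrite gt_eqF.
rewrite le_eqVlt; apply/predU1P; left; apply: eq_bigr => X _.
congr (_ * expR _); rewrite mulr_sumr; apply: eq_bigr => i _.
by rewrite mulr_sumr.
Qed.

Lemma total_score_mean_abs_le (k : 'I_K) :
  \sum_(X : sample n m d) lik g u X * `|total_score g u k X| <=
    16 * Num.max 1 (Num.sqrt ((n * m)%:R / d%:R)).
Proof.
set W := Num.max 1 _.
have dR0 : 0 < d%:R :> R by rewrite ltr0n.
have W1 : 1 <= W by rewrite le_max lexx.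
have W0 : 0 < W by lra.
have W2 : (n * m)%:R <= d%:R * W ^+ 2.
  rewrite mulrC -ler_pdivrMr // -[leLHS]sqr_sqrtr ?divr_ge0 ?ler0n //.
  by rewrite lerXn2r ?nnegrE ?sqrtr_ge0 ?(ltW W0) // le_max lexx orbT.
(* [W >= 1] keeps [l <= 1/4], and [W^2 >= n m / d] gives [n m l^2 <= d / 16]; the resulting bound is
   [4 / l = 16 W]. *)
pose l := (4 * W)^-1; have l0 : 0 < l by rewrite invr_gt0 mulr_gt0.
have l4 : l <= 4^-1 by rewrite lef_pV2 ?posrE ?mulr_gt0 // ler_peMr.
have l2 : (n * m)%:R * l ^+ 2 <= d%:R / 16.
  rewrite exprVn ler_pdivrMr ?exprn_gt0 ?mulr_gt0 //.
  by rewrite exprMn mulrA mulrAC -mulrA; lra.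
have [L0 L1] := lik_pmf n m d0 g01 u1.
have hp : \sum_(X : sample n m d) lik g u X * expR (l * total_score g u k X) <= 2.
  by apply: total_score_mgf_le; rewrite ?ger0_norm // ltW.
have hn : \sum_(X : sample n m d) lik g u X * expR (- (l * total_score g u k X)) <= 2.
  under eq_bigr do rewrite -mulNr.
  by apply: total_score_mgf_le; rewrite ?sqrrN ?normrN ?ger0_norm // ltW.
apply: le_trans (pmf_mean_abs_le L0 l0 hp hn) _.
by rewrite /l invrK le_eqVlt; apply/orP; left; apply/eqP; ring.
Qed.

(** The pairs are disjoint, so at most one score is nonzero at [x] and the bound is free of the
    dimension. *)
Lemma weighted_score_norm_le (c : 'I_K -> R) x :
  (forall k, `|c k| <= 2) -> `|\sum_k c k * score g u k x| <= 4.
Proof.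
move=> c2; apply: le_trans (ler_norm_sum _ _ _) _.
apply: le_trans (_ : \sum_k 2 * `|score g u k x| <= _).
  by apply: ler_sum => k _; rewrite normrM ler_wpM2r.
by rewrite -mulr_sumr; have := sum_norm_score_le2 g01 u1 x; lra.
Qed.

(** Each sample contributes a centered term bounded by 4; with [l^2 = 1 / (64 m)] its variance is at
    most [1 / (4 m)], so the exponent over [m] samples is at most [1/2]. *)
Lemma user_score_mgf_le (c : 'I_K -> R) (l : R) :
  (forall k, `|c k| <= 2) -> `|l| = (8 * Num.sqrt m%:R)^-1 ->
  \sum_(x : {ffun 'I_m -> 'I_d}) prod_pmf (perturbed g u) x *
    expR (l * \sum_j \sum_k c k * score g u k (x j)) <= 2.
Proof.
move=> c2 lE; have pp := perturbed_pmf d0 g01 u1.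
have [p0 p1] := pp.
have mR : 1 <= m%:R :> R by rewrite ler1n.
have sm1 : 1 <= Num.sqrt m%:R :> R by rewrite -[leLHS]sqrtr1 ler_wsqrtr.
have sm0 : 0 < Num.sqrt m%:R :> R by lra.
have l8 : `|l| <= 8^-1 by rewrite lE lef_pV2 ?posrE ?mulr_gt0 // ler_peMr.
have l2 : l ^+ 2 = (64 * m%:R)^-1.
  rewrite -real_normK ?num_real // lE exprVn exprMn sqr_sqrtr ?ler0n //.
  by congr (_ * _)^-1; rewrite -natrX.
pose Y x := l * \sum_k c k * score g u k x.
have Y0 : \sum_x perturbed g u x * Y x = 0.
  under eq_bigr do rewrite mulrCA mulr_sumr.
  rewrite -mulr_sumr exchange_big big1 ?mulr0 //= => k _.
  under eq_bigr do rewrite mulrCA.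
  by rewrite -mulr_sumr score_mean0 ?mulr0.
have Y1 x : `|Y x| <= 2^-1.
  rewrite normrM; have := weighted_score_norm_le x c2.
  by set s := `|\sum_k _|; have s0 : 0 <= s := normr_ge0 _; nra.
have Y2 : \sum_x perturbed g u x * Y x ^+ 2 <= (4 * m%:R)^-1.
  rewrite -[leRHS]mul1r -[X in _ <= X * _]p1 mulr_suml; apply: ler_sum => x _.
  rewrite ler_wpM2l // exprMn l2.
  rewrite -[X in _ * X]real_normK ?num_real //.
  have -> : (4 * m%:R)^-1 = (64 * m%:R)^-1 * 4 ^+ 2 :> R.
    by field; rewrite gt_eqF //; lra.
  rewrite ler_wpM2l ?invr_ge0 ?mulr_ge0 ?ler0n //.
  by rewrite lerXn2r ?nnegrE // weighted_score_norm_le.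
have h1 := prod_pmf_mgf_le 'I_m pp (pmf_mgf_le pp Y0 Y1 Y2).
apply: le_trans (le_trans h1 _); last first.
  apply: expR_half_le2; rewrite card_ord.
  by rewrite le_eqVlt; apply/predU1P; left; field; rewrite gt_eqF //; lra.
rewrite le_eqVlt; apply/predU1P; left; apply: eq_bigr => X _.
by rewrite mulr_sumr.
Qed.

Section Private.
Variables (A : finType) (mu : sample n m d -> A -> R) (eps delta : R).
Hypothesis mu_pmf : forall X, is_pmf (mu X).
Hypotheses (eps0 : 0 < eps) (delta0 : 0 <= delta).
Hypothesis mu_dp : forall X i x,
  dp_dominated (expR eps) delta (mu X) (mu (upd X i x)).

(** The correlation splits over users, and each user is bounded by [dp_user_correlation] with
    [l = 1 / (8 sqrt m)] and [B = 4 m]. The coefficients may depend on the output. *)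
Lemma private_correlation_le (c : A -> 'I_K -> R) :
  (forall a k, `|c a k| <= 2) ->
  \sum_X lik g u X * (\sum_a mu X a * \sum_k c a k * total_score g u k X) <=
    n%:R * (64 * eps * Num.sqrt m%:R + 8 * delta * m%:R).
Proof.
move=> c2; have pp := perturbed_pmf d0 g01 u1.
have mR : 1 <= m%:R :> R by rewrite ler1n.
have sm0 : 0 < Num.sqrt m%:R :> R by rewrite sqrtr_gt0; lra.
pose V a x := \sum_k c a k * score g u k x.
pose Z a (x : {ffun 'I_m -> 'I_d}) := \sum_j V a (x j).
have -> : \sum_X lik g u X * (\sum_a mu X a * \sum_k c a k * total_score g u k X)
    = \sum_(i < n) \sum_X lik g u X * (\sum_a mu X a * Z a (X i)).
  rewrite exchange_big /=; apply: eq_bigr => X _.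
  rewrite -mulr_sumr exchange_big /=; congr (_ * _); apply: eq_bigr => a _.
  rewrite -mulr_sumr; congr (_ * _); rewrite /total_score /Z /V.
  under eq_bigr do rewrite mulr_sumr.
  rewrite exchange_big; apply: eq_bigr => i _ /=.
  under eq_bigr do rewrite mulr_sumr.
  by rewrite exchange_big.
rewrite mulr_natl -[X in _ *+ X]card_ord -sumr_const; apply: ler_sum => i _.
pose l : R := (8 * Num.sqrt m%:R)^-1.
have l0 : 0 < l by rewrite invr_gt0 mulr_gt0.
have lE : `|l| = (8 * Num.sqrt m%:R)^-1 by rewrite ger0_norm ?ltW.
apply: le_trans (@dp_user_correlation R _ _ _ _ mu (is_pmf_prod _ pp) mu_pmf i
  eps delta l (4 * m%:R) Z eps0 delta0 l0 _ _ _ _ _ _) _ => //.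
- move=> a; apply: prod_pmf_mean0; rewrite /V.
  under eq_bigr do rewrite mulr_sumr.
  rewrite exchange_big big1 //= => k _.
  under eq_bigr do rewrite mulrCA.
  by rewrite -mulr_sumr score_mean0 ?mulr0.
- by move=> a; apply: user_score_mgf_le.
- move=> a; under eq_bigr do rewrite -mulNr.
  by apply: user_score_mgf_le; rewrite ?normrN.
- move=> a x; apply: le_trans (ler_norm_sum _ _ _) _.
  rewrite mulr_natr -[X in _ *+ X]card_ord -sumr_const; apply: ler_sum => j _.
  exact: weighted_score_norm_le.
by rewrite /l invrK le_eqVlt; apply/orP; left; apply/eqP; ring.
Qed.

End Private.
End CorrelationBounds.

(** * Lower bounds for finite-valued mechanisms *)

Definition sgn_of (R : realType) (b : bool) : R := if b then 1 else - 1.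

(** The true signs of [u] attain correlation [\sum_k |u k|], and a wrong sign at [k] loses
    [2 |u k|]; the event is a total loss above [t]. *)
Definition sign_errs (R : realType) (K : nat) (u : 'I_K -> R) (t : R)
    (a : {ffun 'I_K -> bool}) : bool :=
  \sum_k u k * sgn_of R (a k) < \sum_k `|u k| - t.

Section FiniteLowerBound.
Variables (R : realType) (n m d : nat) (g : R).
Local Notation K := d./2.
Variable mu : sample n m d -> {ffun 'I_K -> bool} -> R.
Hypotheses (d2 : (1 < d)%N) (g01 : 0 <= g <= 2^-1).
Hypothesis mu_pmf : forall X, is_pmf (mu X).
Hypothesis mu_accurate : forall u : 'I_K -> R, (forall k, `|u k| <= 1) ->
  \sum_(X : sample n m d) lik g u X *
    (\sum_(a | sign_errs u (d%:R / 108) a) mu X a) <= 1 / 3.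

Let d0 : (0 < d)%N. Proof. exact: ltnW. Qed.

Let tau k X := \sum_a mu X a * sgn_of R (a k).

Let sgn1 b : `|sgn_of R b| = 1.
Proof. by case: b; rewrite /sgn_of ?normrN normr1. Qed.

Let tau1 k X : `|tau k X| <= 1.
Proof.
have [q0 q1] := mu_pmf X; apply: le_trans (ler_norm_sum _ _ _) _.
rewrite -q1; apply: ler_sum => a _.
by rewrite normrM sgn1 mulr1 ger0_norm.
Qed.

(** The correlation is at least [s - t] off the error event and at least [- s] on it; error
    probability at most [1/3] leaves [s - t - 2 s / 3]. *)
Lemma sign_correlation_ge (u : 'I_K -> R) : (forall k, `|u k| <= 1) ->
  (\sum_k `|u k|) / 3 - d%:R / 108 <=
  \sum_k u k * (\sum_X lik g u X * tau k X).
Proof.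
move=> u1; have [L0 L1] := lik_pmf n m d0 g01 u1.
set s := \sum_k `|u k|; set t := d%:R / 108.
have s0 : 0 <= s by rewrite sumr_ge0.
have t0 : 0 <= t by rewrite divr_ge0.
have -> : \sum_k u k * (\sum_X lik g u X * tau k X) =
    \sum_X lik g u X * (\sum_a mu X a * \sum_k u k * sgn_of R (a k)).
  under eq_bigr do rewrite mulr_sumr.
  rewrite exchange_big /=; apply: eq_bigr => X _.
  under eq_bigr do rewrite mulrCA.
  rewrite -mulr_sumr /tau; congr (_ * _).
  under eq_bigr do rewrite mulr_sumr.
  rewrite exchange_big /=; apply: eq_bigr => a _.
  by rewrite mulr_sumr; apply: eq_bigr => k _; rewrite mulrCA.
apply: le_trans (_ : \sum_(X : sample n m d) lik g u X *
    (s - t - 2 * s * \sum_(a | sign_errs u t a) mu X a) <= _).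
  have -> : \sum_(X : sample n m d) lik g u X *
      (s - t - 2 * s * \sum_(a | sign_errs u t a) mu X a) =
    (s - t) - 2 * s * (\sum_(X : sample n m d) lik g u X *
      (\sum_(a | sign_errs u t a) mu X a)).
    under eq_bigr do rewrite mulrBr (mulrCA _ (2 * s)).
    by rewrite sumrB -mulr_suml -mulr_sumr L1 mul1r.
  set q := (X in _ - 2 * s * X); have q3 : q <= 1 / 3 := mu_accurate u1.
  by have := ler_wpM2l s0 q3; lra.
apply: ler_sum => X _; rewrite ler_wpM2l //.
have [q0 q1] := mu_pmf X.
rewrite -[s - t]mul1r -[X in X * (s - t)]q1 mulr_suml mulr_sumr.
rewrite [X in _ - X <= _]big_mkcond -sumrB /=; apply: ler_sum => a _.
have h : - s <= \sum_k u k * sgn_of R (a k).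
  rewrite /s -sumrN; apply: ler_sum => k _.
  by have := ler_norm (- (u k * sgn_of R (a k))); rewrite normrN normrM sgn1; lra.
case: ifPn => [_|]; last first.
  by rewrite /sign_errs -leNgt subr0 => ?; rewrite ler_wpM2l.
by have := q0 a; nra.
Qed.

Let W := Num.max 1 (Num.sqrt ((n * m)%:R / d%:R)) : R.

Lemma fingerprint_lower_bound (B : R) :
  (forall (u c : 'I_K -> R), (forall k, `|u k| <= 1) ->
    (forall k, 0 <= c k <= 2) ->
    \sum_k c k * (\sum_X lik g u X * tau k X * total_score g u k X) <= B) ->
  K%:R / 18 <= g * B.
Proof.
move=> cB; have /andP[g0 _] := g01.
(* Makes the discretization error [1/36] per pair. As [d <= 3 K], what remains is at least
   [K / 9 - K / 36 - K / 36 = K / 18]. *)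
pose N := (144 * 3 ^ (n * m))%N.
have N1 : (1 < N)%N by rewrite (@leq_trans 144) // leq_pmulr // expn_gt0.
have N0 : (0 < N)%N by apply: ltnW.
have dK : d%:R <= 3 * K%:R :> R.
  by rewrite -natrM ler_nat; have := odd_double_half d; lia.
have N36 : 4 * 3 ^+ (n * m) / N%:R = 36^-1 :> R.
  by rewrite /N natrM natrX; field; rewrite expf_neq0.
have h1 := fingerprint_identity d0 g01 N1 tau1.
have h2 := sum_upar_norm_ge R d N1.
pose T : R := #|{: param d N}|%:R.
have T0 : 0 < T.
  rewrite ltr0n; apply/card_gt0P; by exists [ffun=> ord0].
have h3 : T * (K%:R / 9 - d%:R / 108) <=
    \sum_(th : param d N) \sum_k upar R th k *
      (\sum_X lik g (upar R th) X * tau k X).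
  apply: le_trans (_ : \sum_(th : param d N)
      ((\sum_k `|upar R th k|) / 3 - d%:R / 108) <= _).
    rewrite sumrB sumr_const -[X in _ <= _ - X]mulr_natl mulrBr -mulr_suml lerD2r.
    rewrite (_ : 9 = 3 * 3) ?invfM; last by rewrite -natrM.
    by rewrite !mulrA ler_pM2r ?invr_gt0 // -mulrA.
  by apply: ler_sum => th _; apply: sign_correlation_ge; apply: upar_norm_le1.
have h4 : \sum_(th : param d N)
    (g * (\sum_k grid_weight R N (th k) *
       \sum_X lik g (upar R th) X * tau k X * total_score g (upar R th) k X)
     + K%:R * (4 * 3 ^+ (n * m) / N%:R)) <= T * (g * B + K%:R / 36).
  rewrite (_ : T * _ = \sum_(th : param d N) (g * B + K%:R / 36)).
    apply: ler_sum => th _; rewrite N36 lerD2r ler_wpM2l //.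
    apply: cB => k; first exact: upar_norm_le1.
    exact: grid_weight_bounds.
  by rewrite sumr_const /T mulr_natl.
have := le_trans h3 (le_trans h1 h4).
by rewrite ler_pM2l //; lra.
Qed.

(** Each pair is bounded separately: weight at most 2, [|tau| <= 1], and mean absolute score at most
    [16 W]. Then [576 = 18 * 32]. *)
Lemma nonprivate_lower_bound : 1 <= 576 * g * W.
Proof.
have K0 : 0 < K%:R :> R by rewrite ltr0n half_gt0.
have /andP[g0 _] := g01.
have : K%:R / 18 <= g * (32 * K%:R * W).
  apply: fingerprint_lower_bound => u c u1 c2.
  apply: le_trans (_ : \sum_(k < K) 2 * (16 * W) <= _); last first.
    rewrite sumr_const card_ord -mulr_natl le_eqVlt; apply/orP; left.
    by apply/eqP; ring.
  have [L0 L1] := lik_pmf n m d0 g01 u1.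
  apply: ler_sum => k _; have /andP[c0 c2k] := c2 k.
  apply: le_trans (ler_wpM2r _ c2k); last first.
    by rewrite mulr_ge0 // le_max ler01.
  rewrite ler_wpM2l //; apply: le_trans (total_score_mean_abs_le n m d0 g01 u1 k).
  apply: ler_sum => X _; rewrite -mulrA ler_wpM2l //.
  apply: le_trans (ler_norm _) _; rewrite normrM ler_piMl //.
have -> : g * (32 * K%:R * W) = K%:R * (32 * g * W) by ring.
by rewrite ler_pM2l //; lra.
Qed.

Lemma private_lower_bound (eps delta : R) :
  (0 < m)%N -> 0 < eps -> 0 <= delta ->
  (forall X i x, dp_dominated (expR eps) delta (mu X) (mu (upd X i x))) ->
  K%:R / 18 <= g * (n%:R * (64 * eps * Num.sqrt m%:R + 8 * delta * m%:R)).
Proof.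
move=> m0 eps0 delta0 mu_dp; apply: fingerprint_lower_bound => u c u1 c2.
apply: le_trans (private_correlation_le d0 m0 g01 u1 mu_pmf eps0 delta0 mu_dp
  (* The grid weight and the output sign merge into one output-dependent coefficient of size at most
     2. *)
  (c := fun a k => c k * sgn_of R (a k)) _).
  rewrite le_eqVlt; apply/predU1P; left.
  under eq_bigr do rewrite mulr_sumr.
  rewrite exchange_big /=; apply: eq_bigr => X _.
  under [in RHS]eq_bigr do rewrite mulr_sumr.
  rewrite exchange_big mulr_sumr /=; apply: eq_bigr => k _.
  rewrite /tau; move: (total_score _ _ _ _) => S.
  rewrite !mulr_sumr mulr_suml mulr_sumr.
  by apply: eq_bigr => a _; ring.
move=> a k; rewrite normrM sgn1 mulr1.
by have /andP[? ?] := c2 k; rewrite ger0_norm.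
Qed.

End FiniteLowerBound.

(** * From mechanisms to sign patterns *)

Lemma measure_preimage_finset disp (T : measurableType disp) (R : realType)
    (P : probability T R) (A : finType) (f : T -> A) :
  (forall a, measurable (f @^-1` [set a])) ->
  forall S : {set A},
    measurable [set q | f q \in S] /\
    fine (P [set q | f q \in S]) = \sum_(a in S) fine (P (f @^-1` [set a])).
Proof.
move=> mf S.
have -> : [set q | f q \in S] = [set q | f q \in enum S].
  by apply/seteqP; split => q /=; rewrite mem_enum.
rewrite -big_enum /=; elim: (enum S) (enum_uniq (mem S)) => [_|a s IH] /=.
  rewrite big_nil (_ : [set q | _] = set0); last by apply/seteqP; split.
  by rewrite measure0.
case/andP => as_ us; have [ms fs] := IH us.
have -> : [set q | f q \in a :: s] = f @^-1` [set a] `|` [set q | f q \in s].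
  apply/seteqP; split => q /=; rewrite inE.
    by case/orP => [/eqP|]; [left|right].
  by case=> [->|->]; rewrite ?eqxx ?orbT.
split; first exact: measurableU.
rewrite measureU //; last first.
  apply/seteqP; split => q //= [-> h]; by rewrite h in as_.
by rewrite fineD ?fin_num_measure // fs big_cons.
Qed.

Lemma ler_fine_measure disp (T : measurableType disp) (R : realType)
    (P : probability T R) (A B : set T) :
  measurable A -> measurable B -> A `<=` B -> fine (P A) <= fine (P B).
Proof.
move=> mA mB AB; rewrite fine_le ?fin_num_measure //.
by apply: le_measure; rewrite ?inE.
Qed.

Section Mechanism.
Variables (R : realType) (n m d : nat) (M : mechanism R n m d).
Local Notation K := d./2.

Definition signs (q : d.-tuple R) : {ffun 'I_K -> bool} :=
  [ffun k => tnth q (hi k) <= tnth q (lo k)].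

Definition matrix_of (X : sample n m d) : dataset n m d := \matrix_(i, j) X i j.

Definition sign_law (X : sample n m d) (a : {ffun 'I_K -> bool}) : R :=
  fine (M (matrix_of X) (signs @^-1` [set a])).

Lemma signs_measurable (a : {ffun 'I_K -> bool}) :
  measurable (signs @^-1` [set a]).
Proof.
have -> : signs @^-1` [set a] =
    \bigcap_(k in [set: 'I_K]) [set q | (tnth q (hi k) <= tnth q (lo k)) = a k].
  apply/seteqP; split => q /= => [<- k _|h]; first by rewrite /= ffunE.
  by apply/ffunP => k; rewrite ffunE; apply: h.
apply: fin_bigcap_measurable => [|k _]; first exact: finite_finset.
have : measurable_fun [set: d.-tuple R] (fun q => tnth q (hi k) <= tnth q (lo k)).
  by apply: measurable_fun_ler; exact: measurable_tnth.
by move=> /(_ measurableT [set a k] I); rewrite setTI.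
Qed.

Lemma sign_law_finset (X : sample n m d) (S : {set {ffun 'I_K -> bool}}) :
  measurable [set q | signs q \in S] /\
  fine (M (matrix_of X) [set q | signs q \in S]) = \sum_(a in S) sign_law X a.
Proof. exact: measure_preimage_finset signs_measurable S. Qed.

Lemma sign_law_pmf X : is_pmf (sign_law X).
Proof.
split=> [a|]; first by rewrite fine_ge0.
have [_] := sign_law_finset X finset.setT.
rewrite (_ : [set q | _] = setT); last first.
  by apply/seteqP; split => q //=; rewrite finset.inE.
by rewrite probability_setT /= => ->; apply: eq_bigl => a; rewrite finset.inE.
Qed.

Lemma neighboring_upd (X : sample n m d) i x :
  neighboring (matrix_of X) (matrix_of (upd X i x)).
Proof.
by exists i => i' /negPf ii j; rewrite !mxE ffunE ii.
Qed.

Lemma sign_law_dp (eps delta : R) X i x : user_level_dp eps delta M ->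
  dp_dominated (expR eps) delta (sign_law X) (sign_law (upd X i x)).
Proof.
move=> dp S; have [mS <-] := sign_law_finset X S.
have [_ <-] := sign_law_finset (upd X i x) S.
have := dp _ _ (neighboring_upd X i x) _ mS.
rewrite -lee_fin EFinD EFinM !fineK ?fin_num_measure //.
Qed.

Lemma sum_dataset (F : dataset n m d -> \bar R) :
  (\sum_X F X = \sum_(X : sample n m d) F (matrix_of X))%E.
Proof.
rewrite (reindex matrix_of) //.
exists (fun X : 'M['I_d]_(n, m) => [ffun i => [ffun j => X i j]]) => X _.
  by apply/ffunP => i; apply/ffunP => j; rewrite !ffunE mxE.
by apply/matrixP => i j; rewrite mxE !ffunE.
Qed.

Lemma tv_dist_ge_measurable (p : d.-tuple R) (t : R) :
  measurable [set q | t <= tv_dist q p].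
Proof.
have : measurable_fun [set: d.-tuple R] (fun q => t <= tv_dist q p).
  apply: measurable_fun_ler; first exact: measurable_cst.
  apply: measurable_funM; first exact: measurable_cst.
  apply: measurable_sum => k; apply: measurableT_comp => //.
  by apply: measurable_funB; [exact: measurable_tnth|exact: measurable_cst].
by move=> /(_ measurableT [set true] I); rewrite setTI.
Qed.

Definition perturbed_tuple (g : R) (u : 'I_K -> R) : d.-tuple R :=
  [tuple perturbed g u x | x < d].

Lemma perturbed_tuple_distr g u : is_pmf (perturbed g u) ->
  is_distr (perturbed_tuple g u).
Proof.
move=> [p0 p1]; split=> [x|]; first by rewrite tnth_mktuple.
by under eq_bigr do rewrite tnth_mktuple.
Qed.

Lemma iid_pmf_perturbed g u X :
  iid_pmf (perturbed_tuple g u) (matrix_of X) = lik g u X.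
Proof.
apply: eq_bigr => i _; apply: eq_bigr => j _.
by rewrite mxE tnth_mktuple.
Qed.

(** A wrong sign on pair [k] forces an error of at least [2 g |u k| / d] on its two atoms. Hence the
    loss [\sum_k (|u k| - u k * sgn)] is at most [d / g] times the l1 distance, which is twice the
    total variation; this gives [216 = 2 * 108]. *)
Lemma sign_errs_tv_dist (g : R) (u : 'I_K -> R) (q : d.-tuple R) :
  (0 < d)%N -> 0 < g -> sign_errs u (d%:R / 108) (signs q) ->
  g / 216 <= tv_dist q (perturbed_tuple g u).
Proof.
move=> d0 g0; apply: contraTT; rewrite -ltNge /sign_errs -leNgt => tv.
have dR0 : 0 < d%:R :> R by rewrite ltr0n.
pose e x := `|tnth q x - tnth (perturbed_tuple g u) x|.
pose D := d%:R / g; have dg : 0 < D by rewrite divr_gt0.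
have h k : `|u k| - u k * sgn_of R (signs q k) <=
    D * (e (lo k) + e (hi k)).
  pose t := g * u k / d%:R.
  have ut : u k = D * t by rewrite /D /t; field; rewrite !gt_eqF.
  have et : tnth (perturbed_tuple g u) (lo k) -
      tnth (perturbed_tuple g u) (hi k) = 2 * t.
    by rewrite !tnth_mktuple /perturbed tilt_lo tilt_hi /t; ring.
  rewrite ut normrM (gtr0_norm dg) -(mulrA D t) -mulrBr ler_pM2l // /e ffunE.
  move: et; move: (tnth _ (lo k)) (tnth _ (hi k)) => p1 p2 et.
  move: (tnth q (lo k)) (tnth q (hi k)) => q1 q2.
  have n1 := ler_norm (q1 - p1); have n2 := ler_norm (q2 - p2).
  have n1' := ler_norm (- (q1 - p1)); have n2' := ler_norm (- (q2 - p2)).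
  rewrite !normrN in n1' n2'; rewrite /sgn_of.
  by case: (ger0P t) => t0; case: (lerP q2 q1) => q12; lra.
rewrite lerBlDr -lerBlDl -sumrB.
apply: le_trans (ler_sum _ (fun k _ => h k)) _; rewrite -mulr_sumr.
have /(ler_wpM2l (ltW dg)) := sum_lo_hi_le (F := e) (fun x => normr_ge0 _).
move/le_trans; apply.
have -> : d%:R / 108 = D * (2 * (g / 216)) by rewrite /D; field; rewrite gt_eqF.
rewrite ler_pM2l //; move: tv; rewrite /tv_dist -/e; lra.
Qed.

End Mechanism.

Lemma sign_errs_prob_le (R : realType) (n m d : nat) (M : mechanism R n m d)
    (g : R) (u : 'I_(d./2) -> R) :
  (0 < d)%N -> 0 < g <= 2^-1 -> (forall k, `|u k| <= 1) ->
  (iid_output_prob M (perturbed_tuple g u)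
     [set q | (g / 216 <= tv_dist q (perturbed_tuple g u))%R] < (1 / 3)%:E)%E ->
  \sum_(X : sample n m d) lik g u X *
    (\sum_(a | sign_errs u (d%:R / 108) a) sign_law M X a) <= 1 / 3.
Proof.
move=> d0 /andP[g0 g1] u1; set p := perturbed_tuple g u; set S := mkset _ => h.
have g01 : 0 <= g <= 2^-1 by rewrite (ltW g0) g1.
have mS : measurable S by apply: tv_dist_ge_measurable.
have [L0 L1] := lik_pmf n m d0 g01 u1.
apply: (@le_trans _ _ (\sum_(X : sample n m d) lik g u X *
    fine (M (matrix_of X) S))).
  apply: ler_sum => X _; rewrite ler_wpM2l //.
  pose E := [set a | sign_errs u (d%:R / 108) a]%SET.
  have -> : \sum_(a | sign_errs u (d%:R / 108) a) sign_law M X a =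
      \sum_(a in E) sign_law M X a.
    by apply: eq_bigl => a; rewrite finset.inE.
  have [mE <-] := sign_law_finset M X E.
  apply: ler_fine_measure => // q; rewrite /= finset.inE.
  exact: sign_errs_tv_dist.
rewrite -lee_fin ltW //; apply: le_lt_trans h.
rewrite /iid_output_prob sum_dataset -sumEFin; apply: lee_sum => X _.
by rewrite iid_pmf_perturbed EFinM fineK ?fin_num_measure.
Qed.

Lemma mechanism_lower_bound (R : realType) (n m d : nat) (eps delta g : R)
    (M : mechanism R n m d) :
  (0 < m)%N -> (1 < d)%N -> 0 < g <= 2^-1 -> 0 < eps -> 0 <= delta ->
  user_level_dp eps delta M ->
  (forall p : d.-tuple R, is_distr p ->
    (iid_output_prob M p [set q | (g / 216 <= tv_dist q p)%R] < (1 / 3)%:E)%E) ->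
  1 <= 576 * g * Num.max 1 (Num.sqrt ((n * m)%:R / d%:R)) /\
  d%:R <= 54 * g * (n%:R * (64 * eps * Num.sqrt m%:R + 8 * delta * m%:R)).
Proof.
move=> m0 d2 g01 eps0 delta0 dp acc; have d0 : (0 < d)%N by apply: ltnW.
have g01' : 0 <= g <= 2^-1 by case/andP: g01 => g0 ->; rewrite ltW.
have dp' X i x := sign_law_dp X i x dp.
have acc' (u : 'I_(d./2) -> R) : (forall k, `|u k| <= 1) ->
    \sum_(X : sample n m d) lik g u X *
      (\sum_(a | sign_errs u (d%:R / 108) a) sign_law M X a) <= 1 / 3.
  move=> u1; apply: sign_errs_prob_le => //; apply: acc.
  exact: perturbed_tuple_distr (perturbed_pmf d0 g01' u1).
split; first exact: (nonprivate_lower_bound d2 g01' (sign_law_pmf M) acc').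
have := private_lower_bound d2 g01' (sign_law_pmf M) acc' m0 eps0 delta0 dp'.
have dK : d%:R <= 3 * (d./2)%:R :> R.
  by rewrite -natrM ler_nat; have := odd_double_half d; lia.
by lra.
Qed.

(** * Comparison with the stated rates and the final constants *)

Lemma log_factor_ge (R : realType) (n m d : nat) (eps : R) :
  2 <= eps^-1 * m%:R * n%:R * d%:R -> 2^-1 <= log_factor n m d eps.
Proof.
move=> h; rewrite -[leLHS]expRK ler_ln ?posrE ?expR_gt0 //; last by lra.
exact: le_trans (expR_half_le2 (lexx _)) h.
Qed.

(** Makes the [delta] term of the private bound comparable to [eps]: the powers of [d] and [n] are
    at least 1, and the squared logarithm is at least [1/4]. *)
Lemma delta_scale_le (R : realType) (n m d : nat) (eps : R) :
  (0 < n)%N -> (0 < m)%N -> (0 < d)%N -> 0 < eps ->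
  2^-1 <= log_factor n m d eps -> delta_scale n m d eps * m%:R <= 4 * eps.
Proof.
move=> n0 m0 d0 eps0; rewrite /delta_scale; set L := log_factor _ _ _ _ => L2.
have L4 : 4^-1 <= L ^+ 2 by rewrite expr2; nra.
have pow1 k (r : R) : (0 < k)%N -> 0 <= r -> 1 <= k%:R `^ r :> R.
  by move=> k0 r0; rewrite -[leLHS](powRr0 k%:R) ler_powR // ler1n.
have a1 : 1 <= d%:R `^ (3 / 2) :> R by apply: pow1 => //; lra.
have b1 : 1 <= n%:R `^ (1 / 2) :> R by apply: pow1 => //; lra.
set a := _ `^ _ in a1 *; set b := _ `^ _ in b1 *.
have mR : 0 < m%:R :> R by rewrite ltr0n.
have ab : 1 <= a * b by nra.
have abL : 4^-1 <= a * b * L ^+ 2 by nra.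
have -> : eps / (a * m%:R * b * L ^+ 2) * m%:R = eps / (a * b * L ^+ 2).
  by field; rewrite !gt_eqF //; lra.
rewrite ler_pdivrMr; last by lra.
by nra.
Qed.

(* The two terms of the rate are matched with the two bounds according to
   which of them dominates. *)
Lemma small_rate_contradiction (R : realType) (n m d : nat) (eps c g : R) :
  (0 < n)%N -> (0 < m)%N -> (0 < d)%N -> 0 < eps ->
  2^-1 <= log_factor n m d eps -> 0 < c -> 2000 * 1000 * c <= 1 ->
  g = c * Num.min 1 (error_rate n m d eps) ->
  1 <= 576 * g * Num.max 1 (Num.sqrt ((n * m)%:R / d%:R)) ->
  d%:R <= 54 * g * (n%:R * (96 * eps * Num.sqrt m%:R)) -> False.
Proof.
move=> n0 m0 d0 eps0 L2 c0 c1; rewrite /error_rate.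
set L := log_factor _ _ _ _ in L2 *.
set A := Num.sqrt (d%:R / _); set B := d%:R / (_ * L ^+ 7) => gE h1 h2.
have nR : 0 < n%:R :> R by rewrite ltr0n.
have mR : 0 < m%:R :> R by rewrite ltr0n.
have dR : 0 < d%:R :> R by rewrite ltr0n.
have sm : 0 < Num.sqrt m%:R :> R by rewrite sqrtr_gt0.
have A0 : 0 <= A by rewrite sqrtr_ge0.
have L7 : 128^-1 <= L ^+ 7.
  have -> : 128^-1 = 2^-1 ^+ 7 :> R by rewrite exprVn -natrX.
  by rewrite lerXn2r ?nnegrE //; lra.
pose Q := eps * n%:R * Num.sqrt m%:R.
have Q0 : 0 < Q by rewrite !mulr_gt0.
have QL0 : 0 < Q * L ^+ 7 by rewrite mulr_gt0 //; lra.
have B0 : 0 <= B by rewrite divr_ge0 ?(ltW QL0).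
have BQ : B * Q <= 128 * d%:R.
  rewrite mulrAC ler_pdivrMr // -/Q.
  by have := ler_wpM2l (ltW (mulr_gt0 dR Q0)) L7; lra.
have g1 : g <= c by rewrite gE (ler_piMr (ltW c0)) // ge_min lexx.
have gAB : g <= c * (A + B) by rewrite gE (ler_wpM2l (ltW c0)) // ge_min lexx orbT.
have [BA|AB] := lerP B A.
  have gA : g <= 2 * c * A by have := ler_wpM2l (ltW c0) BA; lra.
  have AW : A * Num.sqrt ((n * m)%:R / d%:R) = 1.
    rewrite -sqrtrM ?divr_ge0 ?mulr_ge0 ?ltW // natrM.
    rewrite (_ : _ * _ = 1) ?sqrtr1 //; field.
    by rewrite !gt_eqF.
  (* If the maximum is 1, then [g <= c] already contradicts [h1]; otherwise [g W <= 2 c A W = 2 c]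
     does. *)
  move: h1; case: (lerP 1 (Num.sqrt ((n * m)%:R / d%:R))) => W1; last by move=> ?; lra.
  set W := Num.sqrt _ in AW W1 * => h1.
  have : g * W <= 2 * c * (A * W) by nra.
  by rewrite AW; lra.
(* Now [d <= 5184 g Q <= 5184 * 256 * c * d], and [5184 * 256 < 2000 * 1000], which is where the
   bound on [c] comes from. *)
have gB : g <= 2 * c * B by have := ler_wpM2l (ltW c0) (ltW AB); lra.
have : g * Q <= 2 * c * (B * Q) by nra.
have : c * (B * Q) <= c * (128 * d%:R) by rewrite ler_pM2l.
have h3 : 54 * g * (n%:R * (96 * eps * Num.sqrt m%:R)) = 5184 * (g * Q).
  by rewrite /Q; ring.
by rewrite h3 in h2; nra.
Qed.

(* c1 is the threshold in "delta = o(...)" and c2 the constant in "Omega(...)";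
   both are absolute. The minimum with 1 is there because total variation
   distance never exceeds 1, whereas the rate can be arbitrarily large. *)
Theorem theorem5 (R : realType) :
  exists c1 c2 : R, [/\ 0 < c1, 0 < c2 &
    forall (n m d : nat) (eps delta : R) (M : mechanism R n m d),
      (1 <= n)%N -> (1 <= m)%N -> (2 <= d)%N ->
      0 < eps -> 2 <= eps^-1 * m%:R * n%:R * d%:R ->
      0 <= delta -> delta <= c1 * delta_scale n m d eps ->
      outputs_distr M ->
      user_level_dp eps delta M ->
      exists p : d.-tuple R, is_distr p /\
        ((1 / 3)%:E <= iid_output_prob M p
           [set q | (c2 * Num.min 1 (error_rate n m d eps) <= tv_dist q p)%R])%E].
Proof.
have [c c0 c1] : exists2 c : R, 0 < c & 2000 * 1000 * c <= 1.
  have k0 : 0 < 2000 * 1000 :> R by apply: mulr_gt0; rewrite ltr0n.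
  by move: (2000 * 1000 : R) k0 => k k0; exists k^-1; rewrite ?invr_gt0 ?mulfV ?gt_eqF.
(* The factor 216 converts the perturbation size [g] into the total variation threshold of
   [sign_errs_tv_dist]. *)
exists 1, (c / 216); split=> [//||n m d eps delta M n0 m0 d2 eps0 arg2 delta0].
  by rewrite divr_gt0.
rewrite mul1r => delta_le _ dp; have d0 : (0 < d)%N by apply: ltnW.
have L2 := log_factor_ge arg2.
pose g := c * Num.min 1 (error_rate n m d eps).
have g216 : c / 216 * Num.min 1 (error_rate n m d eps) = g / 216 by rewrite /g; ring.
have [//|none] := pselect (exists p : d.-tuple R, is_distr p /\
  ((1 / 3)%:E <= iid_output_prob M p
     [set q | (c / 216 * Num.min 1 (error_rate n m d eps) <= tv_dist q p)%R])%E).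
have rate0 : 0 < error_rate n m d eps.
  rewrite /error_rate ltr_pwDl //.
    by rewrite sqrtr_gt0 divr_gt0 ?mulr_gt0 // ltr0n.
  have L0 : 0 <= log_factor n m d eps by apply: le_trans L2; rewrite invr_ge0.
  by rewrite divr_ge0 // !mulr_ge0 ?exprn_ge0 ?sqrtr_ge0 // ltW.
have g0 : 0 < g by rewrite mulr_gt0 // lt_min ltr01.
have g1 : g <= 2^-1.
  apply: (@le_trans _ _ c); first by rewrite /g (ler_piMr (ltW c0)) // ge_min lexx.
  by lra.
have [||h1 h2] := @mechanism_lower_bound R n m d eps delta g M m0 d2 _ eps0 delta0 dp.
- by rewrite g0.
- move=> p dp_p; rewrite ltNge; apply/negP => acc; apply: none; exists p.
  by rewrite g216.
exfalso; apply: (@small_rate_contradiction R n m d eps c g) => //.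
apply: le_trans h2 _; apply: ler_wpM2l; first by rewrite mulr_ge0 // ltW.
apply: ler_wpM2l => //.
(* Then [8 delta m <= 32 eps <= 32 eps sqrt m], which raises the coefficient 64 to 96. *)
have dm : delta * m%:R <= 4 * eps.
  by apply: le_trans (delta_scale_le n0 m0 d0 eps0 L2); rewrite ler_wpM2r.
have : eps <= eps * Num.sqrt m%:R.
  apply: ler_peMr; first exact: ltW.
  by rewrite -[leLHS]sqrtr1 ler_wsqrtr // ler1n.
by lra.
Qed.
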